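(* Let $f$ be a linear polynomial over $\mathbb{Q}$ which depends on $n$ variables (i.e. has exactly $n$ variables with nonzero coefficients) and satisfies $0\notin im_2(f)$. Then every tree-like $\mathrm{Res}(\mathrm{lin}_{\mathbb{Q}})$ refutation of the linear clause $f=0$ has size $2^{\Omega(\sqrt{n})}$.
   Context: $im_2(f)$ denotes the set of values of $f$ under all 0-1 assignments to its variables. A linear clause over a ring $R$ is a disjunction $(f_1=0)\vee\dots\vee(f_k=0)$ of linear equations with linear forms $f_j=\sum_i a_ix_i+b$ over $R$ (duplicate disjuncts identified); the empty clause stands for false; variables range over $\{0,1\}$. The proof system $\mathrm{Res}(\mathrm{lin}_R)$ has the boolean axioms $x=0\vee x=1$ for every variable $x$ and the rules: resolution (from $C\vee f=0$ and $D\vee g=0$ derive $C\vee D\vee(\alpha f+\beta g=0)$, $\alpha,\beta\in R$), simplification (from $C\vee a=0$ with $a\in R\setminus\{0\}$ a constant derive $C$), weakening (from $C$ derive $C\vee f=0$). A refutation of a set $\phi$ of linear clauses is a sequence of linear clauses ending in the empty clause, each in $\phi$, a boolean axiom, or obtained from earlier ones by a rule. It is tree-like if every occurrence of a clause is used at most once as a premise. Size is the total number of variable occurrences plus the total bit-size of all coefficients. *)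

(* Defs.v *)
From mathcomp Require Import all_boot all_order all_algebra.
From mathcomp Require Import finmap.

Set Implicit Arguments.
Unset Strict Implicit.
Unset Printing Implicit Defensive.

Import GRing.Theory.
Local Open Scope ring_scope.
Local Open Scope fset_scope.

(* The linear form  \sum_i a_i x_i + b  in variables x_0, ..., x_(N-1) is the
   pair (a, b); [R^o] gives the pairs their R-module structure. *)
Notation linform R N := ('rV[R]_N * R^o)%type.

Section LinearForms.
Variables (R : nzRingType) (N : nat).
Implicit Types (f : linform R N) (x : {ffun 'I_N -> bool}).

Definition lvar (i : 'I_N) : linform R N := (delta_mx 0 i, 0).
Definition lconst (a : R) : linform R N := (0, a).

Definition leval f x : R := \sum_(i < N) f.1 0 i * (x i)%:R + f.2.

Definition lvars f : {set 'I_N} := [set i | f.1 0 i != 0].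

Definition im2 f : {pred R} := [pred v | [exists x, leval f x == v]].

End LinearForms.

(* The clause  \/_(f in C) (f = 0); being a finite set, it identifies
   duplicate disjuncts, and fset0 is the empty clause. *)
Notation clause R N := {fset linform R N}.

(* [infers phi P C]: C follows from the list of premises P in one step of a
   Res(lin_R) derivation from phi. The side clauses C and D below may contain
   the disjuncts f, g or a that are displayed next to them. *)
Inductive infers (R : nzRingType) (N : nat) (phi : {pred clause R N}) :
    seq (clause R N) -> clause R N -> Prop :=
| InfHyp (C : clause R N) of C \in phi : infers phi [::] C
| InfBool (i : 'I_N) :
    infers phi [::] [fset lvar R i; (lvar R i - lconst N 1)%R]
| InfRes (C D : clause R N) (f g : linform R N) (alpha beta : R) :
    infers phi [:: C `|` [fset f]; D `|` [fset g]]
      (C `|` D `|` [fset (alpha *: f + beta *: g)%R])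
| InfSimp (C : clause R N) (a : R) of a != 0 :
    infers phi [:: C `|` [fset lconst N a]] C
| InfWeak (C : clause R N) (f : linform R N) :
    infers phi [:: C] (C `|` [fset f]).

Section Refutations.
Variables (R : nzRingType) (N : nat).
Implicit Types (phi : {pred clause R N}) (pi : seq (clause R N)).

(* [prem k] lists the positions in pi of the premises of the k-th line. *)
Definition refutation_with phi pi (prem : nat -> seq nat) : Prop :=
  [/\ (0 < size pi)%N, last fset0 pi = fset0 &
      forall k, (k < size pi)%N ->
        all (fun i => i < k)%N (prem k) /\
        infers phi [seq nth fset0 pi i | i <- prem k] (nth fset0 pi k)].

(* Positions, not clauses, are required to be distinct: a clause may be used
   several times if it is derived as many times. *)
Definition tree_like_refutation phi pi : Prop :=
  exists prem, refutation_with phi pi prem /\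
    uniq [seq i | k <- iota 0 (size pi), i <- prem k].

End Refutations.

(* Number of binary digits; 0 is written with one digit. *)
Definition nat_bits (m : nat) : nat := (trunc_log 2 m).+1.

Definition rat_bits (q : rat) : nat :=
  (nat_bits `|numq q| + nat_bits `|denq q|)%N.

Section Size.
Variable N : nat.

(* Only variables with a nonzero coefficient are written down; the constant
   term always is. *)
Definition linform_size (f : linform rat N) : nat :=
  (#|lvars f| + \sum_(i in lvars f) rat_bits (f.1 ord0 i) + rat_bits f.2)%N.

Definition clause_size (C : clause rat N) : nat :=
  (\sum_(f <- C) linform_size f)%N.

Definition proof_size (pi : seq (clause rat N)) : nat :=
  (\sum_(C <- pi) clause_size C)%N.

End Size.

(* Main.v *)
Require Import Defs.
From mathcomp Require Import all_boot all_order all_algebra.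
From mathcomp Require Import finmap zify ring lra.
From mathcomp Require Import boolp reals exp.

Set Implicit Arguments.
Unset Strict Implicit.
Unset Printing Implicit Defensive.

Import Order.TTheory GRing.Theory Num.Theory.
Local Open Scope ring_scope.

(** An adversary walks up the refutation tree from the empty clause, keeping a
    list [P] of linear forms that it promises not to vanish, and hence the
    nonempty set [U] of 0-1 points where no member of [P] vanishes. It pretends
    that [f] vanishes: every disjunct [g] of the current line satisfies
    [g = c p + a f] on [U] with [c != 0] and [p] in [P]. At a resolution step
    on [g] and [h], if [g] is a multiple of [f] on [U] then [h] is such a
    disjunct at no cost, and symmetrically; otherwise either premise can be
    reached by adding one form to [P], so both subtrees count.

    A promised form is chosen modulo [f] so that all its other shifts by
    multiples of [f] have at least [n / 2] variables. If the adversary were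
    caught at an axiom, a form with at least [n / 2 - 1] variables would vanish
    on [U]. Then the product of the forms in [P] is a nonzero function on the
    cube supported on a hyperplane with that many variables, so its degree is
    at least half that number (injectivity of the up operator below the middle
    layer). Hence [P] has about [n / 4] elements by then, and the tree has
    [2 ^ (n / 8)] leaves, which is more than the bound [2 ^ Omega(sqrt n)]. *)

(** * Up and down operators on the lattice of subsets *)

Section SubsetLattice.
Variable I : finType.

Lemma exchange_setD1_setU1 (V : nmodType) (F : {set I} -> {set I} -> V) :
  \sum_(T : {set I}) \sum_(j in T) F (T :\ j) T =
  \sum_(S : {set I}) \sum_(j | j \notin S) F S (j |: S).
Proof.
rewrite (exchange_big_dep predT) //= [RHS](exchange_big_dep predT) //=.
apply: eq_bigr => j _.
rewrite (reindex_onto (fun S => j |: S) (fun T => T :\ j)) /=; last first.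
  by move=> T jT; rewrite setD1K.
apply: eq_big => [S|S /andP[_ /eqP->] //].
rewrite setU11 /=; apply/eqP/idP => [<-|jS]; first by rewrite !inE eqxx.
by rewrite setU1K.
Qed.

(** Removing [i] and adding [j] commute when [i] lies in [S] and [j] does not, so these terms
    cancel. Only [i = j] remains: it gives [r S] once per element outside [S] on the left and once
    per element of [S] on the right. *)
Lemma up_down_commutator (R : pzRingType) (r : {set I} -> R) (S : {set I}) :
  \sum_(j | j \notin S) \sum_(i in j |: S) r ((j |: S) :\ i) + r S *+ #|S| =
  \sum_(i in S) \sum_(j | j \notin S :\ i) r (j |: (S :\ i)) + r S *+ #|~: S|.
Proof.
have -> : \sum_(j | j \notin S) \sum_(i in j |: S) r ((j |: S) :\ i) =
    r S *+ #|~: S| + \sum_(j | j \notin S) \sum_(i in S) r (j |: (S :\ i)).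
  rewrite -sumr_const.
  under [X in _ = X + _]eq_bigl do rewrite inE.
  rewrite -big_split; apply: eq_bigr => j jS /=.
  rewrite big_setU1 //= setU1K //; congr (_ + _); apply: eq_bigr => i iS.
  congr r; apply/setP => x; rewrite !inE.
  by case: (eqVneq x j) => [->|//]; rewrite andbT; apply: contraNneq jS => ->.
have -> : \sum_(i in S) \sum_(j | j \notin S :\ i) r (j |: (S :\ i)) =
    r S *+ #|S| + \sum_(i in S) \sum_(j | j \notin S) r (j |: (S :\ i)).
  rewrite -sumr_const -big_split; apply: eq_bigr => i iS /=.
  rewrite (bigD1 i) /=; last by rewrite !inE eqxx.
  rewrite setD1K //; congr (_ + _); apply: eq_bigl => j; rewrite !inE.
  by case: (eqVneq j i) => [->|]; rewrite ?iS ?andbT.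
rewrite exchange_big /= addrAC [RHS]addrAC; congr (_ + _); exact: addrC.
Qed.

(* Writing L for the sum over lower neighbours and M for its adjoint, the
   commutator gives 0 = <r, M L r> = |M r|^2 + (#|I| - 2 s) |r|^2. *)
Lemma up_operator_injective (R : realDomainType) (s : nat) (r : {set I} -> R) :
    (forall S, r S != 0 -> #|S| = s) ->
    (forall T : {set I}, \sum_(j in T) r (T :\ j) = 0) ->
    (s.*2 < #|I|)%N ->
  forall S, r S = 0.
Proof.
move=> r_s Lr0 s_lt.
pose M (S : {set I}) := \sum_(j | j \notin S) r (j |: S).
have LM (S : {set I}) : \sum_(i in S) M (S :\ i) = - (r S *+ (#|I| - s.*2)).
  have := up_down_commutator r S.
  rewrite big1 => [|j _]; last exact: Lr0.
  rewrite add0r -/(M _) => E.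
  have [r0|/r_s cS] := eqVneq (r S) 0.
    by move: E; rewrite r0 !mul0rn addr0 oppr0 => <-.
  have cC : #|~: S| = (s + (#|I| - s.*2))%N by have := cardsC S; lia.
  move: E; rewrite cC cS mulrnDr => E; apply/eqP; rewrite -addr_eq0.
  apply/eqP/(addrI (r S *+ s)); rewrite addr0 [RHS]E addrCA.
  by congr (_ + _).
have adj : \sum_(S : {set I}) M S ^+ 2 =
    \sum_(T : {set I}) r T * \sum_(i in T) M (T :\ i).
  under [RHS]eq_bigr do rewrite mulr_sumr.
  rewrite (exchange_setD1_setU1 (fun S T => r T * M S)).
  by apply: eq_bigr => S _; rewrite -mulr_suml expr2.
have r2_le0 : \sum_(S : {set I}) r S ^+ 2 <= 0.
  have: 0 <= \sum_(S : {set I}) M S ^+ 2 by apply: sumr_ge0 => S _; exact: sqr_ge0.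
  rewrite adj; under eq_bigr do rewrite LM mulrN mulrnAr -expr2.
  by rewrite sumrN oppr_ge0 sumrMnl pmulrn_lle0 // subn_gt0.
move=> S; apply/eqP; rewrite -sqrf_eq0.
have: \sum_(S : {set I}) r S ^+ 2 == 0.
  by rewrite eq_le r2_le0 sumr_ge0 // => T _; exact: sqr_ge0.
by rewrite psumr_eq0 => [/allP|T _]; [apply; exact: mem_index_enum | exact: sqr_ge0].
Qed.

End SubsetLattice.

(** * Multilinear polynomials and covers of the cube *)

Section Multilinear.
Variables (R : comPzRingType) (I : finType).
Implicit Types (q : {set I} -> R) (a : I -> R) (b : R) (S T : {set I}).

(* [q T] is the coefficient of the monomial \prod_(j in T) x_j, and a set [S]
   stands for the 0-1 point with support [S]. *)
Definition multilin q S : R := \sum_(T : {set I} | T \subset S) q T.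

Definition affine a b S : R := b + \sum_(j in S) a j.

(** Coefficients of the product after reducing each square x_j^2 to x_j: a variable already in the
    monomial [T] is absorbed, hence the factor [affine a b T]. *)
Definition affine_mul a b q T : R :=
  affine a b T * q T + \sum_(j in T) a j * q (T :\ j).

Lemma multilin_affine_mul a b q S :
  multilin (affine_mul a b q) S = affine a b S * multilin q S.
Proof.
rewrite /multilin /affine_mul /affine big_split /=.
under eq_bigr do rewrite mulrDl.
rewrite big_split /= -addrA -mulr_sumr mulrDl; congr (_ + _).
rewrite -big_split /=.
under eq_bigr do rewrite mulr_suml -big_split /=.
rewrite (exchange_big_dep (mem S)) /=; last by move=> T j /subsetP; apply.
rewrite mulr_suml; apply: eq_bigr => j jS.
rewrite [in RHS](bigID (fun T : {set I} => j \in T)) /= mulrDr big_split /=.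
rewrite -!mulr_sumr; congr (_ + a j * _).
rewrite (reindex_onto (fun T => j |: T) (fun T => T :\ j)) /=; last first.
  by move=> T /andP[_ jT]; rewrite setD1K.
apply: eq_big => [T|T /andP[_ /eqP->] //].
rewrite setU11 andbT subUset sub1set jS /=; congr (_ && _).
apply/eqP/idP => [<-|jT]; first by rewrite !inE eqxx.
by rewrite setU1K.
Qed.

(** By induction on the size of [S]: once the coefficients of all proper subsets vanish, the value
    at [S] is [q S]. *)
Lemma multilin_eq0 q : (forall S, multilin q S = 0) -> forall S, q S = 0.
Proof.
move=> q0 S; have [m] := ubnP #|S|; elim: m S => // m IH S; rewrite ltnS => cS.
have := q0 S; rewrite /multilin (bigD1 S) //= big1 ?addr0 // => T /andP[TS nTS].
apply: IH; apply: leq_trans cS; apply: proper_card.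
by rewrite properEneq nTS.
Qed.

Lemma prod_affine_multilin (ps : seq ((I -> R) * R)) :
  exists q, (forall T, (size ps < #|T|)%N -> q T = 0) /\
    forall S, multilin q S = \prod_(p <- ps) affine p.1 p.2 S.
Proof.
elim: ps => [|p ps [q [q_deg qE]]].
  exists (fun T => (T == set0)%:R); split=> [T|S].
    by rewrite lt0n cards_eq0 => /negPf->.
  rewrite big_nil /multilin (bigD1 set0) ?sub0set //= eqxx big1 ?addr0 //.
  by move=> T /andP[_ /negPf->].
exists (affine_mul p.1 p.2 q); split=> [T|S]; last first.
  by rewrite multilin_affine_mul qE big_cons.
rewrite /= => cT; rewrite /affine_mul q_deg ?(ltnW cT) // mulr0 add0r.
rewrite big1 // => j jT; rewrite q_deg ?mulr0 //.
by move: cT; rewrite (cardsD1 j) jT.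
Qed.

End Multilinear.

(* The product of [ps] is a nonzero multilinear polynomial whose top degree
   part is killed, modulo the squares of the variables, by the linear part of
   [l]; rescaling the variables turns that linear part into the sum of all
   variables. *)
Lemma card_hyperplane_cover (R : realFieldType) (I : finType)
    (ps : seq ((I -> R) * R)) (a : I -> R) (b : R) (S0 : {set I}) :
    (forall j, a j != 0) ->
    \prod_(p <- ps) affine p.1 p.2 S0 != 0 ->
    (forall S, affine a b S * \prod_(p <- ps) affine p.1 p.2 S = 0) ->
  (#|I| <= (size ps).*2)%N.
Proof.
move=> a_n0 S0_n0 cover0.
have [q [q_deg qE]] := prod_affine_multilin ps.
have aq0 : forall T, affine_mul a b q T = 0.
  by apply: multilin_eq0 => S; rewrite multilin_affine_mul qE.
have [S1 qS1] : exists S1, q S1 != 0.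
  apply/existsP; apply/contraT; rewrite negb_exists => /forallP q0.
  move: S0_n0; rewrite -qE /multilin big1 ?eqxx // => T _.
  by apply/eqP; rewrite -[_ == _]negbK.
pose S2 := [arg max_(S > S1 | q S != 0%R) #|S|]%N.
have [qS2 S2_max] : q S2 != 0 /\ forall S, q S != 0 -> (#|S| <= #|S2|)%N.
  by rewrite /S2; case: arg_maxnP.
set s := #|S2| in S2_max.
have s_le : (s <= size ps)%N.
  by rewrite leqNgt; apply: contra qS2 => /q_deg->.
have aS_n0 (S : {set I}) : \prod_(j in S) a j != 0 by exact/prodf_neq0.
pose r (S : {set I}) := if #|S| == s then q S / \prod_(j in S) a j else 0.
suff: (#|I| <= s.*2)%N by move/leq_trans; apply; rewrite leq_double.
rewrite leqNgt; apply/negP => s_lt.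
have /(_ S2) : forall S, r S = 0.
  apply: (up_operator_injective (s := s)) => // [S|T].
    by rewrite /r; case: (#|S| =P s) => //; rewrite eqxx.
  have [cT|cT] := eqVneq #|T| s.+1; last first.
    apply: big1 => j jT; rewrite /r; case: (_ =P s) => // cTj.
    by move: cT; rewrite (cardsD1 j) jT cTj eqxx.
  (* [T] exceeds the degree [s], so only the products of the linear part with monomials of degree
     [s] contribute to its coefficient. *)
  have qT : q T = 0.
    apply/eqP/contraT => /S2_max; rewrite cT ltnn //.
  have := aq0 T; rewrite /affine_mul qT mulr0 add0r => E.
  apply: (mulIf (aS_n0 T)); rewrite mul0r -[RHS]E mulr_suml.
  apply: eq_bigr => j jT.
  have -> : r (T :\ j) = q (T :\ j) / \prod_(i in T :\ j) a i.
    by move: cT; rewrite /r (cardsD1 j) jT add1n => -[->]; rewrite eqxx.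
  by rewrite (big_setD1 j jT) /= [a j * \prod_(_ in _) _]mulrC mulrA divfK // mulrC.
rewrite /r eqxx => /eqP; rewrite mulf_eq0 invr_eq0 (negPf qS2) /=.
by rewrite (negPf (aS_n0 _)).
Qed.

(** * Linear forms and the number of their variables *)

Section LinearFormTheory.
Variables (F : fieldType) (N : nat).
Implicit Types (f g h : linform F N) (x : {ffun 'I_N -> bool}).

Lemma levalD f g x : leval (f + g) x = leval f x + leval g x.
Proof.
rewrite /leval /= addrACA -big_split; congr (_ + _).
by apply: eq_bigr => i _; rewrite mxE mulrDl.
Qed.

Lemma levalZ (c : F) f x : leval (c *: f) x = c * leval f x.
Proof.
rewrite /leval /= mulrDr mulr_sumr; congr (_ + _).
by apply: eq_bigr => i _; rewrite mxE mulrA.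
Qed.

Lemma levalB f g x : leval (f - g) x = leval f x - leval g x.
Proof. by rewrite levalD -scaleN1r levalZ mulN1r. Qed.

Lemma leval_lvar (i : 'I_N) x : leval (lvar F i) x = (x i)%:R.
Proof.
rewrite /leval (bigD1 i) //= mxE !eqxx mul1r big1 ?addr0 // => j ji.
by rewrite mxE (negPf ji) andbF mul0r.
Qed.

Lemma leval_lconst (a : F) x : leval (lconst N a) x = a.
Proof. by rewrite /leval big1 ?add0r //= => i _; rewrite mxE mul0r. Qed.

Lemma card_lvarsD f g : (#|lvars (f + g)%R| <= #|lvars f| + #|lvars g|)%N.
Proof.
apply: leq_trans (leq_card_setU _ _); apply: subset_leq_card.
apply/subsetP => i; rewrite !inE /= mxE; apply: contraNT.
by rewrite negb_or !negbK => /andP[/eqP-> /eqP->]; rewrite addr0.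
Qed.

Lemma lvarsZ (c : F) f : c != 0 -> lvars (c *: f)%R = lvars f.
Proof. by move=> c0; apply/setP => i; rewrite !inE /= mxE mulf_eq0 (negPf c0). Qed.

Lemma lvarsN f : lvars (- f)%R = lvars f.
Proof. by rewrite -scaleN1r lvarsZ // oppr_eq0 oner_eq0. Qed.

Lemma card_lvars_lvar (i : 'I_N) : #|lvars (lvar F i)| = 1%N.
Proof.
rewrite -(cards1 i); congr #|pred_of_set _|; apply/setP => j.
by rewrite !inE /= mxE eqxx /=; case: (j == i); rewrite ?oner_eq0 ?eqxx.
Qed.

Lemma card_lvars_lconst (a : F) : #|lvars (lconst N a)| = 0%N.
Proof. by apply: eq_card0 => i; rewrite !inE /= mxE eqxx. Qed.

(** Two distinct shifts of [g] differ by a nonzero multiple of [f], so they cannot both have fewer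
    than half as many variables as [f]. If one shift is that small, it is taken as the base
    point. *)
Lemma exists_spread_shift f g :
  exists a : F, forall b, b != 0 ->
    (#|lvars f| <= (#|lvars (g + a *: f + b *: f)%R|).*2)%N.
Proof.
have [[a ga]|nsmall] :=
  EM (exists a : F, (#|lvars (g + a *: f)%R|.*2 < #|lvars f|)%N).
  exists a => b b0.
  have : (#|lvars f| <= #|lvars (g + a *: f + b *: f)%R| + #|lvars (g + a *: f)%R|)%N.
    rewrite -(lvarsZ f b0) -(lvarsN (g + a *: f)).
    by apply: leq_trans (card_lvarsD _ _); rewrite addrAC subrr add0r.
  lia.
exists 0 => b b0; rewrite scale0r addr0 leqNgt; apply/negP => small.
by apply: nsmall; exists b.
Qed.

End LinearFormTheory.

(** Freezing the variables outside [q] at their values in [x0] leaves a subcube on which every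
    coefficient of [q] is nonzero, and [x0] still witnesses that the product over [P] is not
    identically zero. *)
Lemma card_lvars_cover (R : realFieldType) (N : nat) (P : seq (linform R N))
    (q : linform R N) (x0 : {ffun 'I_N -> bool}) :
    (forall p, p \in P -> leval p x0 != 0) ->
    (forall x, (forall p, p \in P -> leval p x != 0) -> leval q x = 0) ->
  (#|lvars q| <= (size P).*2)%N.
Proof.
move=> P_x0 P_q; pose I := {j | j \in lvars q}.
pose pt (S : {set I}) : {ffun 'I_N -> bool} :=
  [ffun j => if insub j is Some i then i \in S else x0 j].
pose off (p : linform R N) : R :=
  \sum_(j | j \notin lvars q) p.1 0 j * (x0 j)%:R + p.2.
pose lin (p : linform R N) (i : I) := p.1 0 (val i).
have ptE p S : leval p (pt S) = affine (lin p) (off p) S.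
  rewrite /leval /affine /off (bigID (fun j => j \in lvars q)) /= -addrA addrC.
  congr (_ + _ + _).
    by apply: eq_bigr => j jq; rewrite ffunE insubN.
  rewrite big_sub [RHS]big_mkcond; apply: eq_bigr => i _.
  by rewrite ffunE valK; case: (i \in S); rewrite ?mulr1 ?mulr0.
pose S0 := [set i : I | x0 (val i)].
have ptS0 : pt S0 = x0.
  by apply/ffunP => j; rewrite ffunE; case: insubP => // i _ <-; rewrite inE.
have -> : #|lvars q| = #|{: I}| by rewrite card_sig; apply: eq_card.
rewrite -(size_map (fun p => (lin p, off p))).
apply: (@card_hyperplane_cover R I _ (lin q) (off q) S0).
- by move=> i; have := valP i; rewrite inE.
- rewrite big_map prodf_seq_neq0; apply/allP => p pP /=.
  by rewrite -ptE ptS0 P_x0.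
- move=> S; rewrite -ptE big_map; apply/eqP; rewrite mulf_eq0.
  have [|nz] := boolP (\prod_(p <- P) affine (lin p) (off p) S == 0).
    by rewrite orbT.
  rewrite orbF P_q // => p pP; move: nz; rewrite ptE.
  by rewrite prodf_seq_neq0 => /allP/(_ p pP).
Qed.

(** * Positions of the adversary *)

Section Adversary.
Variables (N : nat) (f : linform rat N).
Let n := #|lvars f|.
Implicit Types (P : seq (linform rat N)) (p g h : linform rat N).
Implicit Types (C : clause rat N).

Definition alive P (x : {ffun 'I_N -> bool}) :=
  forall p, p \in P -> leval p x != 0.

(* The state of the adversary: it has promised that the forms in [P] do not
   vanish, while pretending that [f] does. *)
Record position P : Prop := Position {
  position_alive : exists x, alive P x;
  position_one : lconst N 1 \in P;
  position_spread : forall p, p \in P -> forall b, b != 0 ->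
    (n <= #|lvars (p + b *: f)%R|.*2)%N }.

Definition known_nonzero P g := exists p c a,
  [/\ p \in P, c != 0 & forall x, alive P x -> leval g x = c * leval p x + a * leval f x].

Definition known_zero P g := exists a,
  forall x, alive P x -> leval g x = a * leval f x.

Lemma alive_cons P p x : alive (p :: P) x -> alive P x.
Proof. by move=> px r rP; apply: px; rewrite inE rP orbT. Qed.

Lemma known_nonzero_cons P p g : known_nonzero P g -> known_nonzero (p :: P) g.
Proof.
move=> [r [c [a [rP c0 E]]]]; exists r, c, a; split=> // [|x /alive_cons /E//].
by rewrite inE rP orbT.
Qed.

Lemma position_not_zero P p :
  position P -> ((size P).*2.*2 < n)%N -> p \in P -> ~ known_zero P p.
Proof.
case=> [[x0 x0P] _ spread] lt_n pP [a pE].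
have [a0|a0] := eqVneq a 0.
  by have := x0P _ pP; rewrite (pE _ x0P) a0 mul0r eqxx.
have := spread _ pP (- a); rewrite oppr_eq0 => /(_ a0).
have : (#|lvars (p + - a *: f)%R| <= (size P).*2)%N.
  apply: card_lvars_cover x0P _ => x xP.
  by rewrite levalD levalZ pE // mulNr subrr.
by rewrite -leq_double => le1 /leq_trans/(_ le1); rewrite leqNgt lt_n.
Qed.

Lemma known_nonzero_not_zero P g :
  position P -> ((size P).*2.*2 < n)%N -> known_nonzero P g -> ~ known_zero P g.
Proof.
move=> Ppos lt_n [p [c [a [pP c0 gE]]]] [b gE'].
apply: (position_not_zero Ppos lt_n pP); exists ((b - a) / c) => x xP.
apply: (mulfI c0); rewrite mulrA mulrC [c * _]mulrC divfK //.
have := gE x xP; rewrite gE' // => E; lra.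
Qed.

Lemma no_boolean_axiom P (i : 'I_N) :
    position P -> ((size P).*2.*2.+2 < n)%N ->
    known_nonzero P (lvar rat i) ->
  known_nonzero P (lvar rat i - lconst N 1)%R -> False.
Proof.
move=> [[x0 x0P] _ spread] lt_n.
(* Otherwise [c *: p + a *: f] would agree on the alive points with a form in one variable. It would
   then have at most [2 * size P + 1] variables, fewer than [n / 2]. *)
have no_shift p c a b : p \in P -> c != 0 -> a != 0 ->
    ~ forall x, alive P x -> (x i)%:R - b = c * leval p x + a * leval f x.
  move=> pP c0 a0 E.
  have := spread _ pP (a / c); rewrite mulf_neq0 ?invr_eq0 // => /(_ isT).
  rewrite -(lvarsZ _ c0) scalerDr scalerA mulrC divfK //.
  set l := (c *: p + a *: f)%R.
  set u := (lvar rat i - lconst N b)%R.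
  have u_le1 : (#|lvars u| <= 1)%N.
    apply: leq_trans (card_lvarsD _ _) _.
    by rewrite card_lvars_lvar lvarsN card_lvars_lconst.
  have lu_le : (#|lvars (l - u)%R| <= (size P).*2)%N.
    apply: card_lvars_cover x0P _ => x xP.
    rewrite levalB levalD !levalZ levalB leval_lvar leval_lconst E //.
    by rewrite subrr.
  have := leq_trans (card_lvarsD (l - u) u) (leq_add lu_le u_le1).
  rewrite subrK -leq_double doubleD => l_le /leq_trans/(_ l_le).
  by rewrite addn2 leqNgt lt_n.
move=> [p [c [a [pP c0 pE]]]] [r [d [b [rP d0 rE]]]].
have [a0|a0] := eqVneq a 0; last first.
  by apply: (@no_shift p c a 0 pP c0 a0) => x /pE <-; rewrite subr0 leval_lvar.
have [b0|b0] := eqVneq b 0; last first.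
  apply: (@no_shift r d b 1 rP d0 b0) => x /rE <-.
  by rewrite levalB leval_lvar leval_lconst.
(* Now x_i and x_i - 1 are nonzero multiples of promised forms, so neither vanishes at [x0], which
   is absurd for a 0-1 value. *)
have := pE _ x0P; have := rE _ x0P; rewrite a0 b0 !mul0r !addr0.
rewrite levalB leval_lvar leval_lconst.
have := mulf_neq0 c0 (x0P _ pP); have := mulf_neq0 d0 (x0P _ rP).
by case: (x0 i) => + + E1 E2; rewrite -E1 -E2 ?subrr eqxx.
Qed.

Lemma known_nonzero_resolve P g h (a b : rat) :
    position P -> ((size P).*2.*2 < n)%N ->
    known_nonzero P (a *: g + b *: h)%R -> known_zero P g -> known_nonzero P h.
Proof.
move=> Ppos lt_n [p [c [d [pP c0 eE]]]] [k gE].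
have E x : alive P x -> b * leval h x = c * leval p x + (d - a * k) * leval f x.
  by move=> xP; have := eE x xP; rewrite levalD !levalZ gE //; lra.
(* If [b = 0], the resolvent is a multiple of [g], which would make [p] a multiple of [f] on the
   alive points. *)
have [b0|b0] := eqVneq b 0.
  case: (position_not_zero Ppos lt_n pP); exists (- (d - a * k) / c) => x xP.
  apply: (mulfI c0); rewrite mulrA mulrC [c * _]mulrC divfK //.
  have := E x xP; rewrite b0 mul0r; lra.
exists p, (c / b), ((d - a * k) / b); split=> // [|x xP].
  by rewrite mulf_neq0 ?invr_eq0.
by apply: (mulfI b0); rewrite E //; field.
Qed.

(** The new promise is the spread shift [g + a *: f]. If it killed every alive point, [g] would
    equal [- a *: f] on all of them, making it known to be zero. *)
Lemma position_extend P g :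
    position P -> ~ known_zero P g ->
  exists p, position (p :: P) /\ known_nonzero (p :: P) g.
Proof.
move=> [_ P1 spread] gn0; have [a ga] := exists_spread_shift f g.
exists (g + a *: f)%R; split; last first.
  exists (g + a *: f)%R, 1, (- a); split; rewrite ?mem_head ?oner_eq0 // => x _.
  by rewrite levalD levalZ mul1r mulNr addrK.
split=> [||p]; rewrite ?inE ?P1 ?orbT //; last first.
  by case/predU1P => [->|pP] b b0; [exact: ga | exact: spread].
apply: contrapT => dead; apply: gn0; exists (- a) => x xP.
have [E|nz] := eqVneq (leval (g + a *: f)%R x) 0.
  by move: E; rewrite levalD levalZ; lra.
by case: dead; exists x => p; rewrite inE => /predU1P[->//|]; exact: xP.
Qed.

End Adversary.

(** * Size of the derivation unfolded into a tree *)

Lemma clause_size_gt0 (N : nat) (C : clause rat N) g : g \in C -> (0 < clause_size C)%N.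
Proof.
by move=> gC; rewrite /clause_size (big_rem g) //= /linform_size /rat_bits
  /nat_bits !addnS.
Qed.

Section TreeWeight.
Variables (N : nat) (phi : {pred clause rat N}) (pi : seq (clause rat N)).
Variable prem : nat -> seq nat.
Hypothesis pi_ref : refutation_with phi pi prem.

(** [d] is fuel: premises sit at strictly smaller positions, so [k.+1] units unfold the whole
    derivation of position [k]. *)
Fixpoint weight_upto d k : nat :=
  if d is d'.+1 then
    (clause_size (nth fset0 pi k) + \sum_(i <- prem k) weight_upto d' i)%N
  else 0%N.

Definition weight k := weight_upto k.+1 k.

Lemma prem_lt k i : (k < size pi)%N -> i \in prem k -> (i < k)%N.
Proof. by case: pi_ref => _ _ H /H[/allP lt_k _] /lt_k. Qed.

Lemma weightE k : (k < size pi)%N ->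
  weight k = (clause_size (nth fset0 pi k) + \sum_(i <- prem k) weight i)%N.
Proof.
have stable d : forall i, (i < size pi)%N -> (i < d)%N -> weight_upto d i = weight i.
  have [m] := ubnP d; elim: m d => // m IH [//|d] d_lt i i_pi; rewrite ltnS => i_d.
  rewrite /weight /=; congr (_ + _)%N; apply: eq_big_seq => j j_i.
  have ji := prem_lt i_pi j_i; have j_pi := ltn_trans ji i_pi.
  by rewrite (IH d d_lt j j_pi (leq_trans ji i_d)) (IH i (leq_ltn_trans i_d d_lt) j).
move=> k_pi; rewrite {1}/weight /=; congr (_ + _)%N; apply: eq_big_seq => i i_k.
have ik := prem_lt k_pi i_k; exact: stable (ltn_trans ik k_pi) ik.
Qed.

Lemma weight_prem k i : (k < size pi)%N -> i \in prem k -> (weight i <= weight k)%N.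
Proof.
by move=> k_pi i_k; rewrite (weightE k_pi) (big_rem i) //= addnCA leq_addr.
Qed.

(** Summing [weightE] over all positions, the premise weights on the right involve distinct
    positions before the last one. They are at most the weights of those positions on the left, and
    cancelling leaves the last weight. *)
Lemma weight_last : uniq [seq i | k <- iota 0 (size pi), i <- prem k] ->
  (weight (size pi).-1 <= proof_size pi)%N.
Proof.
move=> prem_uniq; have [pi_gt0 _ _] := pi_ref.
set used := [seq i | k <- iota 0 (size pi), i <- prem k] in prem_uniq.
have total : (\sum_(k <- iota 0 (size pi)) weight k =
    proof_size pi + \sum_(i <- used) weight i)%N.
  rewrite /proof_size (big_nth fset0) /index_iota subn0 big_allpairs_dep -big_split.
  by apply: eq_big_seq => k; rewrite mem_iota => /andP[_ /weightE].
have used_le : (\sum_(i <- used) weight i <= \sum_(i <- iota 0 (size pi).-1) weight i)%N.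
  rewrite (perm_big [seq i <- iota 0 (size pi).-1 | i \in used]).
    by rewrite big_filter [leqRHS](bigID (mem used)) leq_addr.
  apply: uniq_perm => // [|i]; first by rewrite filter_uniq ?iota_uniq.
  rewrite mem_filter; apply/esym/andb_idr.
  move=> /allpairsPdep[k [j [+ jk ->]]]; rewrite !mem_iota /= !add0n => k_pi.
  by have := prem_lt k_pi jk; lia.
rewrite -(leq_add2l (\sum_(i <- iota 0 (size pi).-1) weight i)).
move: total; rewrite -{1}(prednK pi_gt0) -addn1 iotaD big_cat big_seq1 add0n /= => ->.
by rewrite [leqRHS]addnC leq_add2l.
Qed.

Lemma weight_gt0 k : fset0 \notin phi -> (k < size pi)%N -> (0 < weight k)%N.
Proof.
move=> phi0; have [m] := ubnP k; elim: m k => // m IH k k_lt k_pi.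
have [_ _ /(_ k k_pi)[_]] := pi_ref.
have from_prem i : i \in prem k -> (0 < weight k)%N.
  move=> ik; apply: leq_trans (weight_prem k_pi ik).
  have := prem_lt k_pi ik => i_k; apply: IH; lia.
have leaf g : g \in nth fset0 pi k -> (0 < weight k)%N.
  by move=> gC; rewrite weightE // addn_gt0 (clause_size_gt0 gC).
move: from_prem; case: (prem k) => [_|i s /(_ i)]; last by rewrite mem_head => /(_ isT).
move Eprem: [seq _ | _ <- _] => ps.
move EC: (nth fset0 pi k) leaf => C leaf inf; case: inf EC leaf Eprem => //.
  move=> {}C C_phi _ leaf _; have [C0|[g]] := fset_0Vmem C; last exact: leaf.
  by rewrite -C0 C_phi in phi0.
by move=> i _ leaf _; apply: (leaf (lvar rat i)); rewrite !inE eqxx.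
Qed.

End TreeWeight.

(** * The exponential lower bound *)

Section LowerBound.
Variables (N : nat) (f : linform rat N) (pi : seq (clause rat N)).
Variable prem : nat -> seq nat.
Hypothesis pi_ref : refutation_with (pred1 [fset f]%fset) pi prem.

(** [K] is the number of promises that may still be made; each one doubles the bound. *)
Lemma adversary_weight k P K : (k < size pi)%N -> position f P ->
    (4 * (size P + K) < #|lvars f| + 2)%N ->
    (forall g, g \in nth fset0 pi k -> known_nonzero f P g) ->
  (2 ^ K <= weight pi prem k)%N.
Proof.
have [m] := ubnP k; elim: m k P K => // m IH k P [|K] k_lt k_pi Ppos PK known.
  apply: (weight_gt0 pi_ref) k_pi; rewrite inE.
  by apply/eqP => /fsetP/(_ f); rewrite !inE eqxx.
(* The summand 2 in the budget is tuned to this bound: with a promise left, 4 is to be spent, and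
   boolean axioms need 2 to spare. *)
have P_lt : ((size P).*2.*2.+2 < #|lvars f|)%N by lia.
have P_lt' : ((size P).*2.*2 < #|lvars f|)%N by lia.
have [_ _ /(_ k k_pi)[_]] := pi_ref.
move Eprem: [seq _ | _ <- _] => ps.
have sub i P' K' : i \in prem k -> position f P' ->
    (4 * (size P' + K') < #|lvars f| + 2)%N ->
    (forall g, g \in nth fset0 pi i -> known_nonzero f P' g) ->
    (2 ^ K' <= weight pi prem i)%N.
  move=> ik; have ltik := prem_lt pi_ref k_pi ik.
  by apply: IH; lia.
have one i : i \in prem k ->
    (forall g, g \in nth fset0 pi i -> known_nonzero f P g) ->
    (2 ^ K.+1 <= weight pi prem k)%N.
  by move=> ik /(sub _ _ K.+1 ik Ppos PK)/leq_trans; apply; exact: (weight_prem pi_ref).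
move EC: (nth fset0 pi k) known => C known inf.
case: inf EC known Eprem.
- move=> {}C; rewrite inE => /eqP-> _ known _.
  case: (known_nonzero_not_zero Ppos P_lt' (known f _)); first by rewrite inE.
  by exists 1 => x _; rewrite mul1r.
- move=> i _ known _; case: (@no_boolean_axiom _ f P i Ppos P_lt).
    by apply: known; rewrite !inE eqxx.
  by apply: known; rewrite !inE eqxx orbT.
- move=> {}C D g h a b _ known.
  case Ep: (prem k) => [|i [|j [|? ?]]] // [Ei Ej].
  have ik : i \in prem k by rewrite Ep !inE eqxx.
  have jk : j \in prem k by rewrite Ep !inE eqxx orbT.
  have knownC P' : (forall e, known_nonzero f P e -> known_nonzero f P' e) ->
      known_nonzero f P' g -> forall e, e \in nth fset0 pi i -> known_nonzero f P' e.
    move=> PP' gP e; rewrite Ei !inE => /orP[eC|/eqP->//].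
    by apply/PP'/known; rewrite !inE eC.
  have knownD P' : (forall e, known_nonzero f P e -> known_nonzero f P' e) ->
      known_nonzero f P' h -> forall e, e \in nth fset0 pi j -> known_nonzero f P' e.
    move=> PP' hP e; rewrite Ej !inE => /orP[eD|/eqP->//].
    by apply/PP'/known; rewrite !inE eD orbT.
  have eP : known_nonzero f P (a *: g + b *: h)%R.
    by apply: known; rewrite !inE eqxx !orbT.
  have [g0|gn0] := EM (known_zero f P g).
    apply: (one j jk); apply: knownD => //.
    exact: known_nonzero_resolve eP g0.
  have [h0|hn0] := EM (known_zero f P h).
    apply: (one i ik); apply: knownC => //.
    by apply: known_nonzero_resolve h0 => //; rewrite addrC; exact: eP.
  have half l e : l \in prem k -> ~ known_zero f P e ->
      (forall P', (forall e, known_nonzero f P e -> known_nonzero f P' e) ->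
        known_nonzero f P' e -> forall e', e' \in nth fset0 pi l -> known_nonzero f P' e') ->
      (2 ^ K <= weight pi prem l)%N.
    move=> lk en0 knownl; have [p [pPpos pPe]] := position_extend Ppos en0.
    apply: (sub l (p :: P) K lk pPpos); first by rewrite [size _]/= addSnnS.
    by apply: knownl => // e'; exact: known_nonzero_cons.
  rewrite (weightE pi_ref) // Ep !big_cons big_nil addn0 expnS mul2n -addnn.
  apply: leq_trans (leq_addl _ _); apply: leq_add; [exact: half gn0 knownC|exact: half hn0 knownD].
- move=> {}C a a0 _ known; case Ep: (prem k) => [|i [|? ?]] // [Ei].
  apply: (one i); first by rewrite Ep mem_head.
  move=> g; rewrite Ei !inE => /orP[/known//|/eqP->].
  exists (lconst N 1), a, 0; split=> // [|x _]; first by case: Ppos.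
  by rewrite !leval_lconst mulr1 mul0r addr0.
- move=> {}C h _ known; case Ep: (prem k) => [|i [|? ?]] // [Ei].
  apply: (one i); first by rewrite Ep mem_head.
  by move=> g; rewrite Ei => gC; apply: known; rewrite !inE gC.
Qed.

Lemma proof_size_ge : (8 <= #|lvars f|)%N ->
    uniq [seq i | k <- iota 0 (size pi), i <- prem k] ->
  (2 ^ (#|lvars f| %/ 8) <= proof_size pi)%N.
Proof.
move=> f_ge prem_uniq; apply: leq_trans (weight_last pi_ref prem_uniq).
have [pi_gt0 last0 _] := pi_ref.
apply: (adversary_weight (P := [:: lconst N 1])).
- by rewrite ltn_predL.
- split=> [||p]; rewrite ?mem_head //.
    by exists [ffun=> true] => p; rewrite inE => /eqP->; rewrite leval_lconst oner_eq0.
  (* The constant promise is spread because adding a constant to [b *: f] keeps all its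
     variables. *)
  rewrite inE => /eqP-> b b0; rewrite -(lvarsZ f b0).
  apply: leq_trans (leq_trans (card_lvarsD (lconst N 1 + b *: f)%R (- lconst N 1)%R) _).
    by rewrite addrAC subrr add0r.
  by rewrite lvarsN card_lvars_lconst addn0 -addnn leq_addr.
- move: f_ge; rewrite [size _]/=; move: #|lvars f| => m; lia.
- by rewrite nth_last last0.
Qed.

End LowerBound.

Theorem mainTheorem2 (R : realType) :
  exists c : R, 0 < c /\
  exists n0 : nat, forall (n N : nat) (f : linform rat N),
    (n0 <= n)%N ->
    #|lvars f| = n ->
    0 \notin im2 f ->
    forall pi : seq (clause rat N),
      tree_like_refutation (pred1 [fset f]%fset) pi ->
      2 `^ (c * Num.sqrt n%:R) <= (proof_size pi)%:R.
Proof.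
(* For [n >= 8] the rounded quotient [n %/ 8] is at least [n / 16], hence at least
   [Num.sqrt n / 16]. *)
exists (16%:R^-1); split; first by rewrite invr_gt0 ltr0n.
exists 8 => n N f n_ge fn _ pi [prem [pi_ref prem_uniq]].
have := proof_size_ge pi_ref; rewrite fn => /(_ n_ge prem_uniq) size_ge.
have : (2 ^ (n %/ 8))%:R <= (proof_size pi)%:R :> R by rewrite ler_nat.
apply: le_trans; rewrite natrX -powR_mulrn ?ler0n //.
apply: ler_powR; first by rewrite ler1n.
have sqrt_le : Num.sqrt n%:R <= n%:R :> R.
  rewrite -[leRHS]ger0_norm ?ler0n // -sqrtr_sqr ler_wsqrtr //.
  by rewrite expr2 -natrM ler_nat leq_pmull //; lia.
rewrite mulrC ler_pdivrMr ?ltr0n //; apply: le_trans sqrt_le _.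
by rewrite -natrM ler_nat; lia.
Qed.
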